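(* Let $\alpha\ge 0$, let $f\in\Sigma$, and let $\delta$ be a real number. If $$\frac{f(z)-\epsilon z^{-1}}{1-\epsilon}\in ME(\alpha)\qquad\text{for }\delta<\epsilon<1,$$ then $N_{\gamma}(f)\subset ME(\alpha)$, where $\gamma=\dfrac{1}{1+2\alpha}$.
   Context: Let $E=\{z\in\mathbb{C}: 0<|z|<1\}$. Let $\Sigma$ be the family of functions $f(z)=z^{-1}+\sum_{n=0}^{\infty}a_nz^n$ that are analytic in $E$, with a simple pole at $z=0$. For $\alpha\ge 0$, $ME(\alpha)$ is the set of $f\in\Sigma$ such that $\operatorname{Re}(zf(z))>\alpha\,|z^2f'(z)+zf(z)|$ for all $z\in E$. For $f(z)=z^{-1}+\sum_{n=0}^\infty a_nz^n$ in $\Sigma$ and a radius $\rho$, the $\rho$-neighborhood of $f$ is $$N_\rho(f)=\left\{g(z)=z^{-1}+\sum_{k=1}^{\infty}b_kz^k \;:\; g\text{ is analytic in }E\text{ and }\sum_{k=1}^\infty k|a_k-b_k|\le\rho\right\}.$$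
   Formalization: The formal theorem assumes δ < 1; for δ ≥ 1 the condition on ε is vacuous and the claim is false, e.g. f = g = 1/z + 100z lies in N_γ(f) but not in ME(α), since Re(z g(z)) = −80 at z = 0.9i. *)

(* Defs.v *)
From Stdlib Require Import Reals.
From Coquelicot Require Import Coquelicot.

Open Scope C_scope.

(* Functions on the punctured disc are total functions [C -> C]; their values
   outside [E] are never used. *)
Definition E (z : C) : Prop := (0 < Cmod z < 1)%R.

(* The norm on [C_NormedModule] is [Cmod], so [ex_derive] over [C_AbsRing] is
   complex differentiability. *)
Definition analytic_E (f : C -> C) : Prop :=
  forall z : C, E z -> ex_derive (K := C_AbsRing) (V := C_NormedModule) f z.

(* f(z) = 1/z + a_0 + a_1 z + a_2 z^2 + ... on the whole of [E]; the
   coefficients are then uniquely determined by f, and the pole at 0 is simple. *)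
Definition expansion (f : C -> C) (a : nat -> C) : Prop :=
  forall z : C, E z ->
    is_series (K := C_AbsRing) (V := C_NormedModule)
      (fun n : nat => a n * z ^ n) (f z - / z).

Definition Sigma (f : C -> C) : Prop :=
  analytic_E f /\ exists a : nat -> C, expansion f a.

Definition ME (alpha : R) (f : C -> C) : Prop :=
  Sigma f /\
  forall z : C, E z ->
    (Re (z * f z) > alpha * Cmod (z ^ 2 * C_derive f z + z * f z))%R.

(* Members of the neighborhood have no constant term, and the sum ignores the
   constant term of f. [Series] is a junk value on divergent series, hence the
   explicit [ex_series]; the terms are nonnegative, so this is exactly
   finiteness of the sum. *)
Definition neighborhood (rho : R) (f g : C -> C) : Prop :=
  analytic_E g /\
  exists a b : nat -> C,
    expansion f a /\ expansion g b /\ b 0%nat = 0 /\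
    let u := fun n : nat => (INR (S n) * Cmod (a (S n) - b (S n)))%R in
    ex_series u /\ (Series u <= rho)%R.

(* Main.v *)
Require Import Defs.
From Stdlib Require Import Reals Lra Lia.
From Coquelicot Require Import Coquelicot.

(** Letting [eps -> 1] in the hypothesis gives [Re (z f z - 1) >= 0] on [E].  Since
    [z f z - 1] vanishes at 0, its leading term would take negative real values
    in some direction, so it is identically 0 and [f z = 1 / z].  A function
    [g] in the neighborhood is then [1 / z + sum_(k >= 1) b_k z^k] with
    [(1 + 2 alpha) sum k |b_k| <= 1], and as [1 + alpha (k + 1) <= (1 + 2 alpha) k],
    the triangle inequality yields the defining inequality of [ME alpha]. *)

(** * Bounds for complex series *)

Lemma is_series_Cmod_le (u : nat -> C) (v : nat -> R) (l : C) (L : R) :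
  (forall n, (Cmod (u n) <= v n)%R) ->
  is_series (K := C_AbsRing) (V := C_NormedModule) u l ->
  is_series v L -> (Cmod l <= L)%R.
Proof.
  intros Huv Hu Hv.
  apply (is_lim_seq_le (fun n => Cmod (sum_n (G := C_NormedModule) u n))
           (sum_n v) (Cmod l) L).
  - intros n.
    eapply Rle_trans.
    apply (norm_sum_n_m (K := C_AbsRing) (V := C_NormedModule) u 0 n).
    apply sum_n_m_le; exact Huv.
  - exact (filterlim_comp _ _ _ _ _ _ _ _ Hu
      (filterlim_norm (K := C_AbsRing) (V := C_NormedModule) l)).
  - exact Hv.
Qed.

(** Convergent partial sums are bounded, and each later term is a difference of two of them; hence
    the factor 2 in the witness. *)
Lemma is_series_terms_bounded (u : nat -> C) (l : C) :
  is_series (K := C_AbsRing) (V := C_NormedModule) u l ->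
  exists M : R, (0 <= M)%R /\ forall n, (Cmod (u n) <= M)%R.
Proof.
  intros Hu.
  destruct (filterlim_bounded (K := C_AbsRing) (V := C_NormedModule)
              (sum_n (G := C_NormedModule) u)
              (ex_intro _ l Hu)) as [M HM].
  assert (HM' : forall n, (Cmod (sum_n (G := C_NormedModule) u n) <= M)%R)
    by exact HM.
  assert (M0 := Rle_trans _ _ _ (Cmod_ge_0 _) (HM' 0%nat)).
  exists (2 * M)%R; split; [lra|].
  intros [|n].
  - specialize (HM' 0%nat). rewrite sum_O in HM'. lra.
  - assert (H1 := HM' (S n)). assert (H2 := HM' n).
    rewrite sum_Sn in H1. change plus with Cplus in H1.
    set (s := sum_n (G := C_NormedModule) u n) in *.
    replace (u (S n)) with ((s + u (S n)) + - s)%C by ring.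
    eapply Rle_trans; [apply Cmod_triangle|]. rewrite Cmod_opp. lra.
Qed.

(** * Rotation of a complex number onto the negative real axis *)

Lemma polar_form (c : C) :
  Cmod c = 1%R -> exists t : R, c = (cos t, sin t).
Proof.
  intros Hc.
  assert (Hs : ((fst c)² + (snd c)² = 1)%R).
  { assert (H := Cmod2_alt c). rewrite Hc in H. unfold Rsqr, Re, Im in *. lra. }
  destruct c as [x y]; simpl in Hs.
  assert (Hx : (-1 <= x <= 1)%R) by (unfold Rsqr in Hs; nra).
  destruct (Rle_dec 0 y) as [Hy|Hy]; [exists (acos x) | exists (- acos x)%R].
  - rewrite cos_acos, sin_acos by exact Hx. f_equal.
    replace (1 - x²)%R with y² by lra. now rewrite sqrt_Rsqr.
  - rewrite cos_neg, sin_neg, cos_acos, sin_acos by exact Hx. f_equal.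
    replace (1 - x²)%R with (- y)² by (unfold Rsqr in *; lra).
    rewrite sqrt_Rsqr; lra.
Qed.

Lemma de_moivre (t : R) (n : nat) :
  ((cos t, sin t) ^ n = (cos (INR n * t), sin (INR n * t)))%C.
Proof.
  induction n as [|n IH].
  - simpl. now rewrite Rmult_0_l, cos_0, sin_0.
  - rewrite S_INR, Rmult_plus_distr_r, Rmult_1_l, cos_plus, sin_plus.
    simpl Cpow. rewrite IH. unfold Cmult; simpl. f_equal; ring.
Qed.

Lemma exists_opposite_direction (c : C) (p : nat) :
  (1 <= p)%nat ->
  exists w : C, Cmod w = 1%R /\ (w ^ p * c = - Cmod c)%C.
Proof.
  intros Hp.
  destruct (Ceq_dec c 0) as [->|Hc].
  { exists 1%C. rewrite Cmod_1, Cmod_0. split; [easy|ring]. }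
  assert (Hm := proj1 (Cmod_gt_0 c) Hc).
  assert (Hm' : RtoC (Cmod c) <> 0%C) by (intros H; apply RtoC_inj in H; lra).
  (* The required [w] is a [p]-th root of this unit number, because [c * Cconj c] is the square of
     [Cmod c]. *)
  destruct (polar_form (- Cconj c / Cmod c)%C) as [t Ht].
  { rewrite Cmod_div, Cmod_opp, Cmod_conj, Cmod_R, Rabs_pos_eq by (easy || lra).
    field; lra. }
  assert (HpR : INR p <> 0%R) by (apply not_0_INR; lia).
  exists (cos (t / INR p), sin (t / INR p)); split.
  - unfold Cmod; cbn [fst snd].
    rewrite <- sqrt_1. f_equal. rewrite Rplus_comm, <- !Rsqr_pow2.
    apply sin2_cos2.
  - rewrite de_moivre.
    replace (INR p * (t / INR p))%R with t by (field; exact HpR).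
    rewrite <- Ht.
    transitivity (- (c * Cconj c) / Cmod c)%C; [field; exact Hm'|].
    rewrite <- Cmod2_conj, RtoC_pow. field; exact Hm'.
Qed.

(** * Vanishing of the coefficients *)

(** Convergence at [1 / 2] forces the coefficients to grow at most like [2 ^ n], so the tail is
    dominated by a geometric series of ratio [2 * Cmod z <= 1 / 2]. *)
Lemma series_minus_constant_term_le (a : nat -> C) (s : C -> C) :
  (forall z, E z -> is_series (K := C_AbsRing) (V := C_NormedModule)
                      (fun n => a n * z ^ n)%C (s z)) ->
  exists M : R, forall z, (0 < Cmod z <= 1 / 4)%R ->
    (Cmod (s z - a 0%nat) <= M * Cmod z)%R.
Proof.
  intros Hs.
  assert (Hhalf : Cmod (RtoC (1 / 2)) = (1 / 2)%R)
    by (rewrite Cmod_R; apply Rabs_pos_eq; lra).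
  destruct (is_series_terms_bounded _ _ (Hs (RtoC (1 / 2)) ltac:(red; lra)))
    as [M [M0 HM]].
  exists (4 * M)%R. intros z Hz. set (r := Cmod z) in *.
  assert (Ha : forall n, (Cmod (a n * z ^ n) <= M * (2 * r) ^ n)%R).
  { intros n. specialize (HM n). rewrite Cmod_mult, Cmod_pow in *.
    rewrite Hhalf in HM. fold r.
    replace (r ^ n)%R with ((1 / 2) ^ n * (2 * r) ^ n)%R
      by (rewrite <- Rpow_mult_distr; f_equal; field).
    rewrite <- Rmult_assoc. apply Rmult_le_compat_r; [apply pow_le; lra|exact HM]. }
  eapply Rle_trans.
  - apply (is_series_Cmod_le (fun n => a (S n) * z ^ (S n))%C
             (fun n => M * (2 * r) * (2 * r) ^ n)%R _
             (M * (2 * r) * / (1 - 2 * r))%R).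
    + intros n. eapply Rle_trans; [apply Ha|]. simpl. lra.
    + apply (is_series_incr_1 (K := C_AbsRing) (V := C_NormedModule)
               (fun n => a n * z ^ n)%C).
      replace (plus _ _) with (s z); [apply Hs; red; fold r; lra|].
      change plus with Cplus. simpl. ring.
    + apply (is_series_scal (K := R_AbsRing) (V := R_NormedModule)
               (M * (2 * r))%R (fun n => (2 * r) ^ n)%R).
      apply is_series_geom. rewrite Rabs_pos_eq; lra.
  - assert (/ (1 - 2 * r) <= 2)%R.
    { replace 2%R with (/ / 2)%R at 2 by field. apply Rinv_le_contravar; lra. }
    assert (0 <= M * (2 * r))%R by (apply Rmult_le_pos; lra).
    nra.
Qed.

(* Near 0 the sum is [z ^ p * a 0] up to [O(|z| ^ (p + 1))], and this leading
   term can be rotated onto the negative real axis. *)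
Lemma constant_term_eq_0 (a : nat -> C) (s : C -> C) (p : nat) :
  (1 <= p)%nat ->
  (forall z, E z -> is_series (K := C_AbsRing) (V := C_NormedModule)
                      (fun n => a n * z ^ n)%C (s z)) ->
  (forall z, E z -> (0 <= Re (z ^ p * s z)%C)%R) ->
  a 0%nat = 0%C.
Proof.
  intros Hp Hs Hre.
  destruct (series_minus_constant_term_le a s Hs) as [M HM].
  destruct (exists_opposite_direction (a 0%nat) p Hp) as [w [Hw Hwa]].
  (* At [z = r * w] the leading term is [- r ^ p * Cmod (a 0)]; the error must compensate for it,
     and dividing by [r ^ p] leaves this bound. *)
  assert (Hr : forall r, (0 < r <= 1 / 4)%R -> (Cmod (a 0%nat) <= M * r)%R).
  { intros r Hr.
    assert (Hz : Cmod (RtoC r * w) = r)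
      by (rewrite Cmod_mult, Hw, Cmod_R, Rabs_pos_eq; lra).
    set (z := (RtoC r * w)%C) in *.
    assert (H1 := Hre z ltac:(red; lra)).
    assert (H2 := HM z ltac:(lra)). rewrite Hz in H2.
    assert (Hzp : (z ^ p * s z
      = RtoC (- (r ^ p * Cmod (a 0%nat))) + z ^ p * (s z - a 0%nat))%C).
    { replace (RtoC (- (r ^ p * Cmod (a 0%nat)))) with (z ^ p * a 0%nat)%C;
        [ring|].
      unfold z. rewrite Cpow_mult_l, <- Cmult_assoc, Hwa.
      rewrite RtoC_opp, RtoC_mult, RtoC_pow. ring. }
    rewrite Hzp in H1.
    assert (H3 := Rle_trans _ _ _ (Rle_abs _)
                    (re_le_Cmod (z ^ p * (s z - a 0%nat)))).
    rewrite Cmod_mult, Cmod_pow, Hz in H3.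
    assert (H4 : (0 < r ^ p)%R) by (apply pow_lt; lra).
    unfold Re in *. cbn [fst Cplus RtoC] in H1.
    apply (Rmult_le_reg_l (r ^ p)); [exact H4|].
    assert (r ^ p * Cmod (s z - a 0%nat) <= r ^ p * (M * r))%R
      by (apply Rmult_le_compat_l; lra).
    lra. }
  apply Cmod_eq_0. apply Rle_antisym; [|apply Cmod_ge_0].
  (* If [A > 0], a radius at most [A / (2 * M)] would give [A <= A / 2]. *)
  apply Rnot_lt_le. intros Hpos. set (A := Cmod (a 0%nat)) in *.
  assert (HMp : (0 < M)%R) by (specialize (Hr (1 / 4)%R ltac:(lra)); lra).
  assert (H0 : (0 < A / (2 * M))%R) by (apply Rdiv_lt_0_compat; lra).
  specialize (Hr (Rmin (1 / 4) (A / (2 * M)))%R).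
  assert (H := Rmin_l (1 / 4) (A / (2 * M))).
  assert (H' := Rmin_r (1 / 4) (A / (2 * M))).
  assert (H'' : (0 < Rmin (1 / 4) (A / (2 * M)))%R) by (apply Rmin_pos; lra).
  specialize (Hr ltac:(lra)).
  assert (M * Rmin (1 / 4) (A / (2 * M)) <= M * (A / (2 * M)))%R
    by (apply Rmult_le_compat_l; lra).
  replace (M * (A / (2 * M)))%R with (A / 2)%R in H1 by (field; lra).
  lra.
Qed.

(** Once [a 0 = 0], the series is divided by [z] and the exponent [p] raised by one, which leaves
    [z ^ p * s z] unchanged. This is why [p] is arbitrary. *)
Lemma coefficients_eq_0 (n : nat) (a : nat -> C) (s : C -> C) (p : nat) :
  (1 <= p)%nat ->
  (forall z, E z -> is_series (K := C_AbsRing) (V := C_NormedModule)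
                      (fun n => a n * z ^ n)%C (s z)) ->
  (forall z, E z -> (0 <= Re (z ^ p * s z)%C)%R) ->
  a n = 0%C.
Proof.
  revert a s p. induction n as [|n IH]; intros a s p Hp Hs Hre;
    assert (Ha := constant_term_eq_0 a s p Hp Hs Hre); [exact Ha|].
  assert (Hnz : forall z, E z -> z <> 0%C).
  { intros z Hz. apply Cmod_gt_0, Hz. }
  apply (IH (fun k => a (S k)) (fun z => / z * s z)%C (S p)); [lia| |].
  - intros z Hz. specialize (Hnz z Hz).
    apply (is_series_ext (K := C_AbsRing) (V := C_NormedModule)
             (fun k => scal (/ z)%C (a (S k) * z ^ S k)%C)).
    { intros k. change scal with Cmult. simpl. field. exact Hnz. }
    apply (is_series_scal (K := C_AbsRing) (V := C_NormedModule) (/ z)%C).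
    apply (is_series_incr_1 (K := C_AbsRing) (V := C_NormedModule)
             (fun n => a n * z ^ n)%C).
    replace (plus _ _) with (s z); [now apply Hs|].
    change plus with Cplus. rewrite Ha. ring.
  - intros z Hz. specialize (Hnz z Hz).
    replace (z ^ S p * (/ z * s z))%C with (z ^ p * s z)%C
      by (simpl; field; exact Hnz).
    now apply Hre.
Qed.

(** * Derivative bounds from Lipschitz estimates *)

Lemma Cmod_pow_minus_le (w z : C) (n : nat) :
  (Cmod w <= 1)%R -> (Cmod z <= 1)%R ->
  (Cmod (w ^ n - z ^ n) <= INR n * Cmod (w - z))%R.
Proof.
  intros Hw Hz. induction n as [|n IH].
  - simpl. replace (1 - 1)%C with (RtoC 0) by ring. rewrite Cmod_0. lra.
  - replace (w ^ S n - z ^ S n)%C with (w * (w ^ n - z ^ n) + z ^ n * (w - z))%C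
      by (simpl; ring).
    eapply Rle_trans; [apply Cmod_triangle|].
    rewrite !Cmod_mult, Cmod_pow, S_INR.
    assert (Cmod z ^ n <= 1)%R.
    { rewrite <- (pow1 n). apply pow_incr. split; [apply Cmod_ge_0|exact Hz]. }
    assert (H1 := Cmod_ge_0 (w ^ n - z ^ n)). assert (H2 := Cmod_ge_0 (w - z)).
    nra.
Qed.

Lemma is_derive_near (g : C -> C) (z l : C) (eps : R) :
  is_derive (K := C_AbsRing) (V := C_NormedModule) g z l -> (0 < eps)%R ->
  exists d : R, (0 < d)%R /\ forall w, (Cmod (w - z) < d)%R ->
    (Cmod (g w - g z - (w - z) * l) <= eps * Cmod (w - z))%R.
Proof.
  intros [_ Hd] Heps.
  destruct (Hd z (fun P HP => HP) (mkposreal eps Heps)) as [d Hd'].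
  exists d; split; [apply cond_pos|]. intros w Hw. exact (Hd' w Hw).
Qed.

(* Bounding the derivative by a Lipschitz constant makes termwise differentiation
   of the power series unnecessary. *)
Lemma deriv_zg_le (g : C -> C) (z : C) (K : R) :
  E z ->
  ex_derive (K := C_AbsRing) (V := C_NormedModule) g z ->
  (forall w, E w -> (Cmod (w * g w - z * g z) <= K * Cmod (w - z))%R) ->
  (Cmod (z * C_derive g z + g z) <= K)%R.
Proof.
  intros Hz Hex HK.
  assert (Hd := C_derive_correct g z z Hex).
  set (l := C_derive g z) in *.
  apply le_epsilon. intros e He.
  assert (Hl := Cmod_ge_0 l).
  (* Chosen so that [eps + eps * Cmod l = e], the total error below. *)
  set (eps := (e / (1 + Cmod l))%R).
  assert (Heps : (0 < eps)%R) by (apply Rdiv_lt_0_compat; lra).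
  destruct (is_derive_near g z l eps Hd Heps) as [d [Hd0 Hd']].
  red in Hz.
  (* The bounds by [Cmod z] and [1 - Cmod z] keep [z + m / 2] in [E]; [d] controls the remainder of
     the derivative and [eps] the quadratic term. *)
  set (m := Rmin (Rmin d eps) (Rmin (Cmod z) (1 - Cmod z))).
  assert (Hm : (0 < m)%R) by (repeat apply Rmin_pos; lra).
  assert (Hm1 : (m <= d /\ m <= eps /\ m <= Cmod z /\ m <= 1 - Cmod z)%R).
  { unfold m, Rmin. repeat destruct Rle_dec; lra. }
  set (w := (z + RtoC (m / 2))%C).
  assert (Hwz : (w - z = RtoC (m / 2))%C) by (unfold w; ring).
  assert (Hwz' : Cmod (w - z) = (m / 2)%R)
    by (rewrite Hwz, Cmod_R; apply Rabs_pos_eq; lra).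
  assert (Hw1 : (Cmod w <= Cmod z + m / 2)%R).
  { unfold w. eapply Rle_trans; [apply Cmod_triangle|].
    rewrite <- Hwz, Hwz'. lra. }
  assert (Hw2 : (Cmod z <= Cmod w + m / 2)%R).
  { replace z with (w + - (w - z))%C at 1 by ring.
    eapply Rle_trans; [apply Cmod_triangle|]. rewrite Cmod_opp, Hwz'. lra. }
  assert (H1 := HK w ltac:(red; lra)).
  assert (H2 := Hd' w ltac:(lra)).
  (* The increment of [w * g w] is its linear part [(w - z) * (z * l + g z)] plus [w] times the
     remainder of [g] plus [(w - z) ^ 2 * l]. *)
  assert (H3 : (Cmod (w - z) * Cmod (z * l + g z) <=
    Cmod (w * g w - z * g z) +
    (Cmod w * Cmod (g w - g z - (w - z) * l) +
     Cmod (w - z) * Cmod (w - z) * Cmod l))%R).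
  { rewrite <- !Cmod_mult.
    replace ((w - z) * (z * l + g z))%C with
      ((w * g w - z * g z) + - (w * (g w - g z - (w - z) * l)
        + (w - z) * (w - z) * l))%C by ring.
    eapply Rle_trans; [apply Cmod_triangle|]. apply Rplus_le_compat_l.
    rewrite Cmod_opp. apply Cmod_triangle. }
  rewrite Hwz' in *.
  apply (Rmult_le_reg_l (m / 2)); [lra|].
  assert (H4 : (Cmod w * Cmod (g w - g z - (w - z) * l) <= 1 * (eps * (m / 2)))%R).
  { apply Rmult_le_compat; [apply Cmod_ge_0|apply Cmod_ge_0|lra|exact H2]. }
  assert (H5 : (m / 2 * (m / 2) * Cmod l <= m / 2 * (eps * Cmod l))%R).
  { rewrite Rmult_assoc. apply Rmult_le_compat_l; [lra|].
    apply Rmult_le_compat_r; lra. }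
  assert (H6 : (e = eps + eps * Cmod l)%R) by (unfold eps; field; lra).
  rewrite H6. lra.
Qed.

(** * The limiting inequality and the theorem *)

(* Dividing by [1 - eps] turns the condition into
   [1 - eps + Re (z * f z - 1) > alpha * ... >= 0], and [eps -> 1]. *)
Lemma Re_zf_ge (alpha : R) (f : C -> C) (delta : R)
  (halpha : (0 <= alpha)%R) (hdelta : (delta < 1)%R)
  (hME : forall eps : R, (delta < eps < 1)%R ->
     ME alpha (fun z : C => ((f z - RtoC eps * / z) / (RtoC 1 - RtoC eps))%C)) :
  forall z, E z -> (0 <= Re (z ^ 1 * (f z - / z))%C)%R.
Proof.
  intros z Hz. apply le_epsilon. intros e He.
  assert (Hzn : z <> 0%C) by apply Cmod_gt_0, Hz.
  (* [t] plays the role of [1 - eps]: the second bound gives [delta < 1 - t], the first makes the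
     loss at most [e]. *)
  set (t := Rmin e ((1 - delta) / 2)).
  assert (Ht : (0 < t)%R) by (apply Rmin_pos; lra).
  assert (Ht1 : (t <= e)%R) by apply Rmin_l.
  assert (Ht2 : (t <= (1 - delta) / 2)%R) by apply Rmin_r.
  destruct (hME (1 - t)%R ltac:(lra)) as [_ H]. specialize (H z Hz).
  apply (Rle_lt_trans _ _ _ (Rmult_le_pos _ _ halpha (Cmod_ge_0 _))) in H.
  assert (Htn : RtoC t <> 0%C) by (intros K; apply RtoC_inj in K; lra).
  assert (Hden : (1 - RtoC (1 - t) = RtoC t)%C) by (rewrite RtoC_minus; ring).
  replace (z * ((f z - RtoC (1 - t) * / z) / (1 - RtoC (1 - t))))%C
    with (RtoC (/ t) * (z ^ 1 * (f z - / z) + t))%C in H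
    by (rewrite Hden, RtoC_minus, RtoC_inv by lra; simpl; field; now split).
  rewrite re_scal_l in H.
  assert (0 < Re (z ^ 1 * (f z - / z) + t)%C)%R.
  { apply (Rmult_lt_reg_l (/ t)); [now apply Rinv_0_lt_compat|]. lra. }
  unfold Re in *. cbn [fst Cplus RtoC] in H0. lra.
Qed.

Theorem theorem3p2 (alpha : R) (f : C -> C) (delta : R)
  (halpha : (0 <= alpha)%R)
  (hf : Sigma f)
  (hdelta : (delta < 1)%R)
  (hME : forall eps : R, (delta < eps < 1)%R ->
     ME alpha (fun z : C => ((f z - RtoC eps * / z) / (RtoC 1 - RtoC eps))%C)) :
  forall g : C -> C,
    neighborhood (1 / (1 + 2 * alpha))%R f g -> ME alpha g.
Proof.
  intros g [Hg [a [b [Ha [Hb [Hb0 [Hex Hle]]]]]]].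
  assert (Ha0 : forall n, a n = 0%C).
  { intros n. apply (coefficients_eq_0 n a (fun z => f z - / z)%C 1 (le_n 1) Ha).
    exact (Re_zf_ge alpha f delta halpha hdelta hME). }
  set (u := fun n => (INR (S n) * Cmod (b (S n)))%R).
  assert (Hu : forall n, (INR (S n) * Cmod (a (S n) - b (S n)) = u n)%R).
  { intros n. unfold u. rewrite Ha0, <- (Cmod_opp (b (S n))).
    do 2 f_equal. ring. }
  apply (ex_series_ext _ _ Hu) in Hex. rewrite (Series_ext _ _ Hu) in Hle.
  split; [split; [exact Hg|now exists b]|].
  intros z Hz.
  (* Here [k] is [S n]: [u], [v] and [x] have the terms [k |b_k|], [|b_k|] and [(k + 1) |b_k|], with
     sums [L], [T] and [L + T]. *)
  set (v := fun n => Cmod (b (S n))).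
  set (x := fun n => (INR (S (S n)) * Cmod (b (S n)))%R).
  assert (Hv0 : forall n, (0 <= v n)%R) by (intros n; apply Cmod_ge_0).
  assert (HINR : forall n, (0 <= INR n)%R) by exact pos_INR.
  assert (Hv : forall n, (v n <= u n)%R).
  { intros n. unfold u. fold (v n). rewrite S_INR.
    specialize (Hv0 n). specialize (HINR n). nra. }
  assert (Hx : forall n, (x n = u n + v n)%R).
  { intros n. unfold x, u. fold (v n). rewrite (S_INR (S n)). ring. }
  assert (Hexv : ex_series v).
  { apply (ex_series_le (K := R_AbsRing) (V := R_CompleteNormedModule) v u);
      [|exact Hex].
    intros n. change (Rabs (v n) <= u n)%R. now rewrite Rabs_pos_eq. }
  assert (HTL : (Series v <= Series u)%R).
  { apply Series_le; [|exact Hex]. intros n; split; [apply Hv0|apply Hv]. }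
  set (T := Series v) in *. set (L := Series u) in *.
  assert (HsT : is_series v T) by now apply Series_correct.
  assert (HsS : is_series x (L + T)%R).
  { apply (is_series_ext (K := R_AbsRing) (V := R_NormedModule)
             (fun n => u n + v n)%R); [now intros n; rewrite Hx|].
    apply (is_series_plus (K := R_AbsRing) (V := R_NormedModule) u v);
      now apply Series_correct. }
  (* Multiplying the expansion by [w] turns the pole into 1; as [b 0 = 0], the series starts with
     [b 1 * w ^ 2]. *)
  assert (Hser : forall w, E w ->
    is_series (K := C_AbsRing) (V := C_NormedModule)
      (fun n => b (S n) * w ^ S (S n))%C (w * g w - 1)%C).
  { intros w Hw.
    assert (Hwn : w <> 0%C) by apply Cmod_gt_0, Hw.
    apply (is_series_incr_1 (K := C_AbsRing) (V := C_NormedModule)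
             (fun n => b n * w ^ S n)%C).
    replace (plus _ _) with (w * (g w - / w))%C.
    2: { change plus with Cplus. rewrite Hb0. field. exact Hwn. }
    apply (is_series_ext (K := C_AbsRing) (V := C_NormedModule)
             (fun n => scal w (b n * w ^ n)%C)).
    { intros n. change scal with Cmult. simpl. ring. }
    apply (is_series_scal (K := C_AbsRing) (V := C_NormedModule)).
    now apply Hb. }
  (* On the unit disc [w ^ (k + 1)] is Lipschitz with constant [k + 1], so [w * g w] has Lipschitz
     constant [L + T]. *)
  assert (HD : (Cmod (z * C_derive g z + g z) <= L + T)%R).
  { apply deriv_zg_le; [exact Hz|now apply Hg|].
    intros w Hw. red in Hw, Hz.
    apply (is_series_Cmod_le
             (fun n => b (S n) * w ^ S (S n) - b (S n) * z ^ S (S n))%C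
             (fun n => x n * Cmod (w - z))%R).
    - intros n.
      replace (b (S n) * w ^ S (S n) - b (S n) * z ^ S (S n))%C
        with (b (S n) * (w ^ S (S n) - z ^ S (S n)))%C by ring.
      rewrite Cmod_mult. unfold x.
      rewrite (Rmult_comm (INR _)), Rmult_assoc.
      apply Rmult_le_compat_l; [apply Cmod_ge_0|].
      apply Cmod_pow_minus_le; lra.
    - replace (w * g w - z * g z)%C with ((w * g w - 1) + - (z * g z - 1))%C
        by ring.
      apply (is_series_minus (K := C_AbsRing) (V := C_NormedModule));
        now apply Hser.
    - now apply is_series_scal_r. }
  (* The factor [Cmod z < 1] is kept because it makes the final inequality strict. *)
  assert (HT : (Cmod (z * g z - 1) <= Cmod z * T)%R).
  { apply (is_series_Cmod_le _ (fun n => Cmod z * v n)%R _ _) with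
      (2 := Hser z Hz); [|now apply (is_series_scal (V := R_NormedModule))].
    intros n. rewrite Cmod_mult, Cmod_pow. fold (v n). red in Hz.
    assert (Cmod z ^ S n <= 1)%R by (rewrite <- (pow1 (S n)); apply pow_incr; lra).
    rewrite Rmult_comm. apply Rmult_le_compat_r; [apply Hv0|].
    change (Cmod z * Cmod z ^ S n <= Cmod z)%R. nra. }
  replace (z ^ 2 * C_derive g z + z * g z)%C
    with (z * (z * C_derive g z + g z))%C by (simpl; ring).
  rewrite Cmod_mult.
  assert (HRe : (1 - Cmod (z * g z - 1) <= Re (z * g z))%R).
  { assert (H := Rle_trans _ _ _ (Rle_abs _) (re_le_Cmod (- (z * g z - 1)))).
    rewrite Cmod_opp in H. unfold Re in *.
    cbn [fst Cplus Cminus Copp RtoC] in *. lra. }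
  assert (HL : ((1 + 2 * alpha) * L <= 1)%R).
  { replace 1%R with ((1 + 2 * alpha) * (1 / (1 + 2 * alpha)))%R at 2
      by (field; lra).
    apply Rmult_le_compat_l; lra. }
  red in Hz.
  assert (alpha * (Cmod z * Cmod (z * C_derive g z + g z))
            <= Cmod z * (alpha * (L + T)))%R.
  { rewrite (Rmult_comm (Cmod z)), <- Rmult_assoc, Rmult_comm.
    apply Rmult_le_compat_l; [lra|]. now apply Rmult_le_compat_l. }
  (* From [T <= L], the left side is at most [(1 + 2 * alpha) * L]. *)
  assert (T + alpha * (L + T) <= 1)%R by nra.
  assert (Cmod z * (T + alpha * (L + T)) <= Cmod z * 1)%R
    by (apply Rmult_le_compat_l; lra).
  lra.
Qed.
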